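(* Let $(\mathfrak{X},\Gamma,\Phi)$ be a renormalizable equicontinuous Cantor action. Then either the action is quasi-analytic, and in this case $\Gamma$ is renormalizable and the action is topologically conjugate to the action $(X_\varphi,\Gamma,\Phi_\varphi)$ given by a renormalization $\varphi$ of $\Gamma$, or the action is wild.
   Context: A Cantor action $(\mathfrak{X},\Gamma,\Phi)$ is a minimal action $\Phi\colon\Gamma\times\mathfrak{X}\to\mathfrak{X}$ by homeomorphisms of a finitely generated group $\Gamma$ on a Cantor metric space $\mathfrak{X}$. A set $U\subset\mathfrak{X}$ is adapted to the action if it is non-empty, clopen, and $\Phi(\gamma)(U)\cap U\neq\emptyset$ implies $\Phi(\gamma)(U)=U$ for all $\gamma\in\Gamma$. For $U$ adapted, $\Gamma_U=\{\gamma\in\Gamma\mid\Phi(\gamma)(U)=U\}$, $H_U\subset\mathrm{Homeo}(U)$ is the image of $\Gamma_U$ under restriction to $U$, and $(U,H_U,\Phi_U)$ is the resulting action of $H_U$ on $U$. A Cantor action $(\mathfrak{X},\Gamma,\Phi)$ is renormalizable if it is equicontinuous and there exist an adapted proper clopen subset $U\subset\mathfrak{X}$, a homeomorphism $\lambda\colon\mathfrak{X}\to U$ and a group isomorphism $\Theta\colon\Gamma\to H_U$ such that $\Phi(\gamma)=\lambda^{-1}\circ\Phi_U(\Theta(\gamma))\circ\lambda$ for all $\gamma\in\Gamma$, and $\bigcap_{\ell\ge0}\lambda^\ell(\mathfrak{X})$ is a point. An action $\Phi\colon H\times\mathfrak{X}\to\mathfrak{X}$ of a topological group $H$ on a Cantor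 metric space is quasi-analytic if for each non-empty clopen $U\subset\mathfrak{X}$ and $g\in H$ with $\Phi(g)(U)=U$ and $\Phi(g)|U=\mathrm{id}_U$, the map $\Phi(g)$ is the identity on $\mathfrak{X}$. It is locally quasi-analytic if there is $\varepsilon>0$ such that for any non-empty open $U$ with $\mathrm{diam}(U)<\varepsilon$ and any non-empty open $V\subset U$, if $g\in H$ satisfies $\Phi(g)(V)=V$ and $\Phi(g)|V=\mathrm{id}_V$, then $\Phi(g)$ is the identity on $U$. For an equicontinuous Cantor action, let $\overline{\Phi(\Gamma)}$ be the closure of $\Phi(\Gamma)\subset\mathrm{Homeo}(\mathfrak{X})$ in the uniform topology (a profinite group). The action is stable if the action of $\overline{\Phi(\Gamma)}$ on $\mathfrak{X}$ is locally quasi-analytic, and wild otherwise. A renormalization of $\Gamma$ is an injective homomorphism $\varphi\colon\Gamma\to\Gamma$ whose image is a proper subgroup of finite index; $\Gamma$ is renormalizable if it admits one. The associated action $(X_\varphi,\Gamma,\Phi_\varphi)$ is the action of $\Gamma$ by left translation on $X_\varphi=\varprojlim \Gamma/\varphi^\ell(\Gamma)$. Topologically conjugate means that there is a homeomorphism of the spaces intertwining the two $\Gamma$-actions. *)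

(* Defs.v *)
From HB Require Import structures.
From mathcomp Require Import all_boot all_order all_algebra.
From mathcomp Require Import all_classical all_reals all_analysis.

Set Implicit Arguments.
Unset Strict Implicit.
Unset Printing Implicit Defensive.

Import Order.TTheory GRing.Theory Num.Theory.

Local Open Scope classical_set_scope.
Local Open Scope ring_scope.

Section groups.
Variable G : groupType.

Definition is_subgroup (H : set G) : Prop :=
  [/\ H 1%g, (forall x y, H x -> H y -> H (x * y)%g)
    & (forall x, H x -> H x^-1%g)].

Definition finitely_generated : Prop :=
  exists2 S : set G, finite_set S &
    forall H : set G, is_subgroup H -> S `<=` H -> H = setT.

Definition left_coset (H : set G) (g : G) : set G := [set (g * h)%g | h in H].

Definition left_cosets (H : set G) : set (set G) := range (left_coset H).

Definition is_renormalization (phi : {multiplicative G -> G}) : Prop :=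
  [/\ injective phi, range phi != setT & finite_set (left_cosets (range phi))].

Definition renormalizable_group : Prop :=
  exists phi : {multiplicative G -> G}, is_renormalization phi.

Lemma left_coset_mul (H : set G) (g k : G) :
  left_coset [set (k * h)%g | h in H] g = left_coset H (g * k)%g.
Proof.
rewrite /left_coset; apply/seteqP; split=> [_ [_ [h Hh <-] <-]|_ [h Hh <-]].
  by exists h => //; rewrite mulgA.
by exists (k * h)%g; [exists h | rewrite mulgA].
Qed.

Lemma left_cosets_translate (H : set G) (g : G) (c : left_cosets H) :
  left_coset (val c) g \in left_cosets H.
Proof.
apply/mem_set; have [k _ <-] := set_valP c.
by exists (g * k)%g => //; rewrite left_coset_mul.
Qed.

Definition translate (H : set G) (g : G) (c : left_cosets H) : left_cosets H :=
  exist _ (left_coset (val c) g) (left_cosets_translate g c).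

End groups.

Section inverse_limit.
Variables (G : groupType) (phi : {multiplicative G -> G}).

Definition iter_image (l : nat) : set G := range (iter l phi).

Definition coset_sequences : Type :=
  prod_topology (fun l => discrete_topology (left_cosets (iter_image l))).

HB.instance Definition _ := Topological.on coset_sequences.

(* The bonding maps of the inverse limit are the projections
   [g phi^(l+1)(G) |-> g phi^l(G)].  The type [renorm_limit] carries the
   subspace topology of the product of the discrete coset spaces. *)
Definition renorm_limit : set coset_sequences :=
  [set x | forall l, exists g : G,
     set_val (x l.+1) = left_coset (iter_image l.+1) g /\
     set_val (x l) = left_coset (iter_image l) g].

Lemma renorm_limit_translate (g : G) (x : renorm_limit) :
  ((fun l => translate g (set_val x l)) : coset_sequences) \in renorm_limit.
Proof.
apply/mem_set => l; have [k [e1 e2]] := set_valP x l.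
exists (g * k)%g; rewrite -!left_coset_mul.
by rewrite -[X in left_coset X g]e1 -[X in _ /\ _ = left_coset X g]e2.
Qed.

Definition renorm_limit_action (g : G) (x : renorm_limit) : renorm_limit :=
  exist _ (fun l => translate g (set_val x l)) (renorm_limit_translate g x).

End inverse_limit.

Arguments renorm_limit {G} phi _.
Arguments renorm_limit_action {G} phi g x.

Definition homeomorphism (X Y : topologicalType) (f : X -> Y) : Prop :=
  continuous f /\
  exists g : Y -> X, [/\ continuous g, cancel f g & cancel g f].

Definition topologically_conjugate (G : Type) (X Y : topologicalType)
    (Phi : G -> X -> X) (Psi : G -> Y -> Y) : Prop :=
  exists2 f : X -> Y, homeomorphism f & forall g x, f (Phi g x) = Psi g (f x).

Section actions.
Variables (R : realType) (X : metricType R).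

Definition diam (U : set X) : \bar R :=
  ereal_sup [set (mdist z.1 z.2)%:E | z in U `*` U].

(* For an action of a topological group [H], the topology and the group law of
   [H] do not enter the next two definitions, only the family of maps does. *)
Definition quasi_analytic (H : Type) (Phi : H -> X -> X) : Prop :=
  forall (U : set X) (g : H), U !=set0 -> clopen U ->
    Phi g @` U = U -> (forall x, U x -> Phi g x = x) ->
    forall x, Phi g x = x.

Definition locally_quasi_analytic (H : Type) (Phi : H -> X -> X) : Prop :=
  exists2 eps : R, 0 < eps &
    forall U : set X, U !=set0 -> open U -> (diam U < eps%:E)%E ->
    forall V : set X, V !=set0 -> open V -> V `<=` U ->
    forall g : H, Phi g @` V = V -> (forall x, V x -> Phi g x = x) ->
    forall x, U x -> Phi g x = x.

Variables (G : groupType) (Phi : G -> X -> X).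

Definition cantor_action : Prop :=
  [/\ finitely_generated G,
      cantor_like X /\ [set: X] !=set0,
      (forall x, Phi 1%g x = x) /\
        (forall g h x, Phi (g * h)%g x = Phi g (Phi h x)),
      (forall g, homeomorphism (Phi g))
    & (forall x, closure (range (Phi ^~ x)) = setT)].

Definition equicontinuous_action : Prop :=
  forall eps : R, 0 < eps -> exists2 delta : R, 0 < delta &
    forall (g : G) (x y : X), mdist x y < delta ->
      mdist (Phi g x) (Phi g y) < eps.

Definition adapted (U : set X) : Prop :=
  [/\ U !=set0, clopen U
    & forall g, (Phi g @` U) `&` U !=set0 -> Phi g @` U = U].

Definition set_stabilizer (U : set X) : set G := [set g | Phi g @` U = U].

(* The group [H_U] of restrictions to [U], under composition. *)
Definition restricted_group (U : set X) : set (U -> U) :=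
  [set h | exists2 g, set_stabilizer U g &
             forall x : U, set_val (h x) = Phi g (set_val x)].

Definition renormalizable_action : Prop :=
  equicontinuous_action /\
  exists (U : set X) (lam : X -> U) (lam' : U -> X) (Theta : G -> U -> U),
    [/\ adapted U /\ U != setT,
        [/\ continuous lam, continuous lam', cancel lam lam' & cancel lam' lam],
        set_bij [set: G] (@restricted_group U) Theta /\
          (forall g h, Theta (g * h)%g = Theta g \o Theta h),
        (forall g x, Phi g x = lam' (Theta g (lam x)))
      & exists x, \bigcap_l range (iter l (fun y => set_val (lam y))) = [set x]].

Definition closure_group : set (X -> X) :=
  closure (range Phi : set {uniform X -> X}) `&`
  [set h | homeomorphism (h : X -> X)].

Definition stable_action : Prop :=
  locally_quasi_analytic (fun h : closure_group => set_val h).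

Definition wild_action : Prop := ~ stable_action.

End actions.

(* Main.v *)
Require Import Defs.
From HB Require Import structures.
From mathcomp Require Import all_boot all_order all_algebra.
From mathcomp Require Import all_classical all_reals all_analysis.

(** Write [L : X -> X] for the contraction obtained by composing the given
homeomorphism [X -> U] with the inclusion of [U], and [W_l] for the clopen set
[L^l(X)].  The sets [W_l] decrease to a point, so by compactness their diameters
tend to 0.  The renormalization says that [L] carries the action of [G] on [X]
to the action on [U = W_1] of the stabilizer of [U]: every [g] has a partner [h]
with [Phi h (L x) = L (Phi g x)], and every [h] stabilizing [U] is such a
partner.

Stable implies quasi-analytic ([stable_quasi_analytic]): if [g] is the identity
on a nonempty open set [V], then some [h] acts on [W_l] as [L^l g L^-l], and it
is the identity on the open subset [L^l(V)] of [W_l].  For large [l] the set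
[W_l] is smaller than the scale of local quasi-analyticity, so [h] is the
identity on all of [W_l], that is, [g] is the identity on [X].

Quasi-analytic implies conjugate to an inverse limit: two elements that agree on
[U] are now equal, so the partner [h] of [g] is unique, and [g |-> h] is an
injective endomorphism [phi] of [G] ([exists_intertwiner], [intertwiner_inj]).
By induction on [l], an element that moves some point of [W_l] into [W_l] lies
in [phi^l(G)] ([domain_return]).  Hence the translates of [W_l] partition [X],
and the elements [g] with [x] in [g W_l] form a left coset of [phi^l(G)], the
[code] of [x] at level [l] ([codeE]).

Codes are locally constant, which by compactness gives the finite index of
[phi(G)]; that [phi(G)] is proper comes from minimality and [U != X].  The
sequence of codes of [x] is a point of the inverse limit.  The resulting map is
onto because nested nonempty closed sets meet, and it is one-to-one with
continuous inverse because equicontinuity makes all the translates of [W_l]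
uniformly small when [W_l] is small ([code_small]). *)

Set Implicit Arguments.
Unset Strict Implicit.
Unset Printing Implicit Defensive.

Import Order.TTheory GRing.Theory Num.Theory.

Local Open Scope classical_set_scope.
Local Open Scope ring_scope.

(** * Compactness *)

Lemma nested_subset (T : Type) (A : nat -> set T) (m n : nat) :
  (forall k, A k.+1 `<=` A k) -> (m <= n)%N -> A n `<=` A m.
Proof.
move=> Anest; elim: n => [|n IHn]; first by rewrite leqn0 => /eqP ->.
rewrite leq_eqVlt => /predU1P[-> //|]; rewrite ltnS => /IHn sub.
exact: subset_trans (Anest n) sub.
Qed.

Lemma compact_nested_meet (T : topologicalType) (A : nat -> set T) :
  compact [set: T] -> (forall n, closed (A n)) -> (forall n, A n !=set0) ->
  (forall n, A n.+1 `<=` A n) -> \bigcap_n A n !=set0.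
Proof.
move=> cT Acl A0 Anest.
pose F : set_system T := filter_from [set: nat] A.
have FF : ProperFilter F.
  apply: filter_from_proper => [|n _]; last exact: A0.
  apply: filter_from_filter; first by exists 0%N.
  move=> i j _ _; exists (maxn i j) => // x Ax.
  by split; apply: nested_subset Ax; rewrite // ?leq_maxl ?leq_maxr.
have [x [_ Fx]] := cT F FF filterT.
exists x => n _; apply: Acl => B xB.
by apply: Fx xB; exists n.
Qed.

(** Otherwise the traces of the sets [A n] on the complement of [W] would be
nested, closed and nonempty, hence would meet. *)
Lemma compact_nested_sub (T : topologicalType) (A : nat -> set T) (W : set T) :
  compact [set: T] -> (forall n, closed (A n)) ->
  (forall n, A n.+1 `<=` A n) -> open W -> \bigcap_n A n `<=` W ->
  exists n, A n `<=` W.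
Proof.
move=> cT Acl Anest oW AW; apply: contrapT => /forallNP noA.
have [|||x Ax] := @compact_nested_meet T (fun n => A n `&` ~` W) cT.
- by move=> n; apply: closedI => //; exact: open_closedC.
- by move=> n; have /nonsubset := noA n.
- by move=> n x [/Anest Ax Wx].
by case: (Ax 0%N I) => _; apply; apply: AW => n _; case: (Ax n I).
Qed.

(** If the range were infinite, the sets of points whose value avoids a given
finite set would generate a proper filter; at a cluster point the value could
not be avoided. *)
Lemma compact_locally_constant_finite (T : topologicalType) (Y : Type)
    (f : T -> Y) :
  compact [set: T] -> (forall x, nbhs x [set y | f y = f x]) ->
  finite_set (range f).
Proof.
move=> cT floc; apply: contrapT => infin.
pose F : set_system T :=
  filter_from [set B : set Y | finite_set B] (fun B => f @^-1` ~` B).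
have FF : ProperFilter F.
  apply: filter_from_proper => [|B finB].
    apply: filter_from_filter; first by exists set0; exact: finite_set0.
    move=> B C finB finC; exists (B `|` C); first by rewrite /= finite_setU.
    by move=> x /= nBC; split=> ?; apply: nBC; [left|right].
  apply: contrapT => noB; apply: infin; apply: sub_finite_set finB => _ [x _ <-].
  by apply: contrapT => nB; apply: noB; exists x.
have [x [_ Fx]] := cT F FF filterT.
have Fvx : F (f @^-1` ~` [set f x]) by exists [set f x] => //; exact: finite_set1.
by have [y [ny yx]] := Fx _ _ Fvx (floc x); exact: ny yx.
Qed.

(** * The contraction carried by a renormalizable action *)

Section contraction.
Variables (R : realType) (X : metricType R) (G : groupType) (Phi : G -> X -> X).

(** The data of a renormalizable action, restated for a self-map of [X] so that
it can be iterated.  The fields [contraction_lift] and [contraction_descent] say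
that restriction to [range L], transported by [L], identifies the stabilizer of
[range L] modulo its kernel with [G]. *)
Record contraction (L : X -> X) : Prop := Contraction {
  contraction_continuous : continuous L;
  contraction_inj : injective L;
  contraction_open : forall A, open A -> open (L @` A);
  contraction_point : exists x0, \bigcap_l range (iter l L) = [set x0];
  contraction_proper : range L != setT;
  contraction_adapted : adapted Phi (range L);
  contraction_lift : forall g, exists h, forall x, Phi h (L x) = L (Phi g x);
  contraction_descent : forall h, set_stabilizer Phi (range L) h ->
    exists g, forall x, Phi h (L x) = L (Phi g x);
  contraction_faithful : forall g, (forall x, Phi g x = x) -> g = 1%g
}.

(** Faithfulness comes from the injectivity of the isomorphism onto the group of
restrictions: an element acting trivially on [X] is sent to the same restriction
as [1]. *)
Lemma renormalizable_action_contraction :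
  cantor_action Phi -> renormalizable_action Phi -> exists L, contraction L.
Proof.
move=> [_ _ [Phi1 _] _ _] [_ [U [lam [lam' [Th]]]]].
move=> [ [adU UT] [cl cl' K K']
  [ [Tfun Tinj Tsurj] _] PhiE pt].
pose L x := set_val (lam x).
have LT g x : L (Phi g x) = set_val (Th g (lam x)) by rewrite /L PhiE K'.
have rL : range L = U.
  apply/seteqP; split=> [_ [x _ <-]|u Uu]; first exact: set_valP.
  exists (lam' (exist _ u (mem_set Uu))) => //.
  by rewrite /L K'.
exists L; split.
- by move=> x; apply: continuous_comp; [exact: cl | exact: initial_continuous].
- by move=> x y /val_inj /(can_inj K).
- move=> A oA.
  have [B oB BE] : open (lam' @^-1` A).
    by apply: open_comp => // ? _; exact: cl'.
  (* A set relatively open in [U] is the trace of an open set [B] of [X]; it is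
     open in [X] because [U] is. *)
  have -> : L @` A = U `&` B.
    apply/seteqP; split=> [_ [x Ax <-]|u [Uu Bu]].
      split; first exact: set_valP.
      suff : (set_val @^-1` B) (lam x) by [].
      by rewrite BE /= K.
    pose v : U := exist _ u (mem_set Uu).
    exists (lam' v); last by rewrite /L K'.
    suff : (lam' @^-1` A) v by [].
    by rewrite -BE.
  by apply: openI => //; case: adU => _ [].
- exact: pt.
- by rewrite rL.
- by rewrite rL.
- move=> g; have [h _ hE] := Tfun g I.
  by exists h => x; rewrite LT hE.
- move=> h; rewrite rL => hU.
  have hfun (u : U) : Phi h (set_val u) \in U.
    have : (Phi h @` U) (Phi h (set_val u)).
      by exists (set_val u) => //; exact: set_valP.
    by move=> hu; apply/mem_set; rewrite -[X in X _]hU.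
  pose r (u : U) : U := exist (fun x => x \in U) _ (hfun u).
  have [|g _ gE] := Tsurj r; first by exists h.
  by exists g => x; rewrite LT gE.
- move=> g gE; apply: Tinj; rewrite ?in_setE //.
  apply/funext => u; apply: (can_inj K').
  by rewrite -[u]K' -!PhiE gE Phi1.
Qed.

End contraction.

(** * Domains of the iterated contraction *)

Section domains.
Variables (R : realType) (X : metricType R) (G : groupType) (Phi : G -> X -> X).
Variable L : X -> X.
Hypotheses (cantorPhi : cantor_action Phi) (cL : contraction Phi L).

Let Phi1 x : Phi 1%g x = x.
Proof. by case: cantorPhi => _ _ []. Qed.

Let PhiM g h x : Phi (g * h)%g x = Phi g (Phi h x).
Proof. by case: cantorPhi => _ _ []. Qed.

Let PhiK g x : Phi g^-1%g (Phi g x) = x.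
Proof. by rewrite -PhiM mulVg Phi1. Qed.

Let PhiVK g x : Phi g (Phi g^-1%g x) = x.
Proof. by rewrite -PhiM mulgV Phi1. Qed.

Let Phi_continuous g : continuous (Phi g).
Proof. by case: cantorPhi => _ _ _ /(_ g)[]. Qed.

Let X_compact : compact [set: X].
Proof. by case: cantorPhi => _ [[]]. Qed.

Definition domain (l : nat) : set X := range (iter l L).

Lemma iter_continuous l : continuous (iter l L).
Proof.
elim: l => [|l IHl] x; first exact: cvg_id.
by apply: (@continuous_comp _ _ _ (iter l L) L);
  [exact: IHl | exact: contraction_continuous cL _].
Qed.

Lemma iter_inj l : injective (iter l L).
Proof. by elim: l => [|l IHl] x y //= /(contraction_inj cL)/IHl. Qed.

Lemma iter_open l A : open A -> open (iter l L @` A).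
Proof.
elim: l => [|l IHl] oA; first by rewrite image_id.
rewrite (_ : _ @` _ = L @` (iter l L @` A)); last by rewrite image_comp.
by apply: contraction_open cL _ _; exact: IHl.
Qed.

Lemma domain_open l : open (domain l).
Proof. by apply: iter_open; exact: openT. Qed.

Lemma domain_closed l : closed (domain l).
Proof.
apply: compact_closed; first by case: cantorPhi => _ [[]].
by apply: continuous_compact => //; apply: continuous_subspaceT;
  exact: iter_continuous.
Qed.

Lemma domain_nonempty l : domain l !=set0.
Proof. by case: cantorPhi => _ [_ [x _]]; exists (iter l L x); exists x. Qed.

Lemma domain_nested l : domain l.+1 `<=` domain l.
Proof. by move=> _ [x _ <-]; exists (L x) => //; rewrite -iterSr. Qed.

Lemma domain_small (eps : R) : 0 < eps ->
  exists l, forall x y, domain l x -> domain l y -> mdist x y < eps.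
Proof.
move=> eps0; have [x0 x0E] := contraction_point cL.
have e20 : 0 < eps / 2 by rewrite divr_gt0.
have [|||||l sub] := @compact_nested_sub X domain (interior (ball x0 (eps / 2))).
- exact: X_compact.
- exact: domain_closed.
- exact: domain_nested.
- exact: open_interior.
- by rewrite /domain x0E => _ ->; exact: nbhsx_ballx.
exists l => x y /sub/interior_subset + /sub/interior_subset.
rewrite ballEmdist /= => x0x x0y; rewrite (splitr eps).
apply: le_lt_trans (metric_triangle x x0 y) _.
by rewrite ltrD // metric_sym.
Qed.

Lemma lift_iter l g :
  exists h, forall x, Phi h (iter l L x) = iter l L (Phi g x).
Proof.
elim: l => [|l [h hE]]; first by exists g.
have [k kE] := contraction_lift cL h.
by exists k => x; rewrite !iterS kE hE.
Qed.

(** Zooming into a small domain turns the local form of quasi-analyticity into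
the global one: [l] is chosen so that [domain l] is below the scale [eps], and
[g] is replaced by the element that acts on [domain l] as its conjugate by
[L^l]. *)
Lemma stable_quasi_analytic : stable_action Phi -> quasi_analytic Phi.
Proof.
move=> [eps eps0 lqa] U g [u Uu] [oU _] _ gU x.
have [l small] := @domain_small (eps / 2) (divr_gt0 eps0 (ltr0Sn _ _)).
have [h hE] := lift_iter l g.
have hcl : closure_group Phi (Phi h).
  split; last by case: cantorPhi => _ _ _ /(_ h).
  by apply: subset_closure; exists h.
have hV y : (iter l L @` U) y -> Phi h y = y.
  by move=> [z Uz <-]; rewrite hE gU.
have hVE : Phi h @` (iter l L @` U) = iter l L @` U.
  apply/seteqP; split=> [_ [y Vy <-]|y Vy]; first by rewrite hV.
  by exists y => //; exact: hV.
apply: (@iter_inj l); rewrite -hE.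
apply: (lqa (domain l) _ _ _ (iter l L @` U) _ _ _
  (exist _ (Phi h) (mem_set hcl))) => //=.
- exact: domain_nonempty.
- exact: domain_open.
- apply: (@le_lt_trans _ _ (eps / 2)%:E); last first.
    by rewrite lte_fin ltr_pdivrMr // ltr_pMr // ltr1n.
  apply: ge_ereal_sup => _ [[y z] [/= Wy Wz] <-].
  by rewrite lee_fin; exact: ltW (small _ _ Wy Wz).
- by exists (iter l L u); exists u.
- exact: iter_open.
- by move=> _ [z _ <-]; exists z.
- by exists x.
Qed.

(** * The renormalization of the group *)

Section renormalization.
Hypothesis qaPhi : quasi_analytic Phi.

(** [k^-1 h] is the identity on the clopen set [range L], hence everywhere. *)
Lemma agree_on_range h k :
  (forall x, Phi h (L x) = Phi k (L x)) -> h = k.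
Proof.
move=> hk; apply: (@mulgI _ k^-1%g); rewrite mulVg.
apply: (contraction_faithful cL).
have [rL0 rLclopen _] := contraction_adapted cL.
have fixr y : range L y -> Phi (k^-1 * h)%g y = y.
  by move=> [x _ <-]; rewrite PhiM hk PhiK.
apply: (@qaPhi (range L)) => //.
apply/seteqP; split=> [_ [y ry <-]|y ry]; first by rewrite fixr.
by exists y => //; exact: fixr.
Qed.

(** Any choice of lifts is multiplicative, since lifts are unique. *)
Lemma exists_intertwiner : exists phi : {multiplicative G -> G},
  forall g x, Phi (phi g) (L x) = L (Phi g x).
Proof.
have [phi phiE] := choice (contraction_lift cL).
have phiM : {morph phi : g h / (g * h)%g}.
  move=> g h; apply: agree_on_range => x.
  by rewrite PhiM !phiE PhiM.
pose m : {multiplicative G -> G} :=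
  HB.pack phi (isMultiplicative.Build G G phi phiM).
by exists m.
Qed.

Variable phi : {multiplicative G -> G}.
Hypothesis phiE : forall g x, Phi (phi g) (L x) = L (Phi g x).

Lemma intertwiner_inj : injective phi.
Proof.
move=> g h gh; apply: (@mulgI _ h^-1%g); rewrite mulVg.
apply: (contraction_faithful cL) => x; apply: (contraction_inj cL).
by rewrite -phiE gmulfM PhiM gh -PhiM -gmulfM mulVg phiE Phi1.
Qed.

Lemma intertwiner_iter l g x :
  Phi (iter l phi g) (iter l L x) = iter l L (Phi g x).
Proof. by elim: l => //= l IHl; rewrite phiE IHl. Qed.

(** The domains are adapted, with stabilizers the iterated images of [phi].  An
element returning a point of [domain l.+1] to [domain l.+1] meets the adapted
set [range L], so it is [phi k] for some [k]; cancelling one factor [L], this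
[k] returns a point of [domain l] to [domain l]. *)
Lemma domain_return l g x y :
  Phi g (iter l L x) = iter l L y -> iter_image phi l g.
Proof.
elim: l g x y => [|l IHl] g x y /= gxy; first by exists g.
have [k kE] : exists k, forall x, Phi g (L x) = L (Phi k x).
  apply: (contraction_descent cL).
  have [_ _] := contraction_adapted cL; apply.
  exists (L (iter l L y)); split; last by exists (iter l L y).
  by exists (L (iter l L x)) => //; exists (iter l L x).
have -> : g = phi k by apply: agree_on_range => z; rewrite phiE kE.
move: gxy; rewrite kE => /(contraction_inj cL)/IHl[h _ <-].
by exists h.
Qed.

(** * Coding points by cosets *)

(** The label of the translate of [domain l] that contains [x]: by [codeE] a left
coset of the stabilizer of [domain l]. *)
Definition code (l : nat) (x : X) : set G := [set g | domain l (Phi g^-1%g x)].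

Lemma codeE l k x : code l x k -> code l x = left_coset (iter_image phi l) k.
Proof.
move=> [y _ yE]; apply/seteqP; split=> [g [z _ zE]|_ [_ [h _ <-] <-]].
  exists (k^-1 * g)%g; last by rewrite mulVKg.
  by apply: (@domain_return _ _ z y); rewrite zE yE PhiM PhiVK.
exists (Phi h^-1%g y) => //.
apply: (can_inj (PhiK (k * iter l phi h)%g)).
by rewrite PhiVK PhiM intertwiner_iter PhiVK yE PhiVK.
Qed.

(** The orbit of [x] is dense, so it enters the open set [domain l]. *)
Lemma code_nonempty l x : code l x !=set0.
Proof.
have [w Ww] := domain_nonempty l.
have /(_ x) dense_orbit : forall x, closure (range (Phi^~ x)) = setT.
  by case: cantorPhi.
have : closure (range (Phi^~ x)) w by rewrite dense_orbit.
case/(_ (domain l)).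
  by apply: open_nbhs_nbhs; split=> //; exact: domain_open.
by move=> _ [[g _ <-] Wg]; exists g^-1%g; rewrite /code /= invgK.
Qed.

Lemma code_coset l x : left_cosets (iter_image phi l) (code l x).
Proof. by have [k /codeE ->] := code_nonempty l x; exists k. Qed.

Lemma code_nested l x : code l.+1 x `<=` code l x.
Proof. by move=> g /domain_nested. Qed.

Lemma code_surj l k : exists x, code l x = left_coset (iter_image phi l) k.
Proof.
have [w Ww] := domain_nonempty l.
by exists (Phi k w); apply: codeE; rewrite /code /= PhiK.
Qed.

(** If [k] is in the code of [x], all the points of the clopen translate of
[domain l] by [k] have the same code. *)
Lemma code_locally_constant l x : nbhs x [set y | code l y = code l x].
Proof.
have [k xk] := code_nonempty l x.
have : nbhs x (Phi k^-1%g @^-1` domain l).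
  apply: Phi_continuous; apply: open_nbhs_nbhs.
  by split=> //; exact: domain_open.
by apply: filterS => y yk /=; rewrite (codeE xk); exact: codeE.
Qed.

Lemma code_translate l k x :
  code l (Phi k x) = left_coset (code l x) k.
Proof.
apply/seteqP; split=> [g Wg|_ [g Wg <-]].
  exists (k^-1 * g)%g; last by rewrite mulVKg.
  by rewrite /code /= invgM invgK PhiM.
by rewrite /code /= invgM PhiM PhiK.
Qed.

(** If [phi] were onto, the orbit of a point of [range L] would stay in this
closed set, which by minimality would be all of [X].  The left cosets of the
image of [phi] are the codes at level 1, of which there are finitely many. *)
Lemma intertwiner_renormalization : is_renormalization phi.
Proof.
split; first exact: intertwiner_inj.
  apply/eqP => phiT; have /eqP := contraction_proper cL; apply.
  have [_ [x _]] : cantor_like X /\ [set: X] !=set0 by case: cantorPhi.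
  have : closure (range (Phi^~ (L x))) = setT by case: cantorPhi.
  move=> orbitT; apply/seteqP; split=> // y _.
  apply: (@domain_closed 1%N).
  have : closure (range (Phi^~ (L x))) y by rewrite orbitT.
  apply: closure_subset => _ [g _ <-].
  have [h _ <-] : range phi g by rewrite phiT.
  by rewrite phiE; exists (Phi h x).
apply: sub_finite_set (compact_locally_constant_finite X_compact
  (code_locally_constant 1)).
by move=> _ [k _ <-]; have [x xE] := code_surj 1 k; exists x.
Qed.

(** * The conjugacy with the inverse limit *)

Hypothesis equiPhi : equicontinuous_action Phi.

(** Equal codes at level [l] put [x] and [y] in one translate of [domain l];
equicontinuity bounds the diameters of all translates at once. *)
Lemma code_small (eps : R) : 0 < eps ->
  exists l, forall x y, code l x = code l y -> mdist x y < eps.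
Proof.
move=> /equiPhi[delta /domain_small[l small] equi].
exists l => x y xy; have [k xk] := code_nonempty l x.
rewrite -(PhiVK k x) -(PhiVK k y); apply: equi; apply: small => //.
by have : code l y k by rewrite -xy.
Qed.

Definition coset_of_point (l : nat) (x : X) :
    discrete_topology (left_cosets (iter_image phi l)) :=
  exist _ (code l x) (mem_set (code_coset l x)).

Lemma coset_of_point_compatible x :
  ((fun l => coset_of_point l x) : coset_sequences phi) \in renorm_limit phi.
Proof.
apply/mem_set => l; have [g xg] := code_nonempty l.+1 x.
exists g; split; first exact: codeE.
exact/codeE/code_nested.
Qed.

Definition encode (x : X) : renorm_limit phi :=
  exist (fun s => s \in renorm_limit phi) _ (coset_of_point_compatible x).

Lemma encode_code x l : set_val (set_val (encode x) l) = code l x.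
Proof. by []. Qed.

Lemma encode_continuous : continuous encode.
Proof.
apply: continuous_comp_initial => x.
apply/cvg_sup => l; move: x; apply: continuous_comp_initial => x.
apply/discrete_cvg.
by apply: filterS (code_locally_constant l x) => y yx; exact: val_inj.
Qed.

(** The points whose code at level [l] is prescribed by [s] form a nonempty
closed set, and these sets are nested because [s] is compatible with the
projections of the cosets. *)
Lemma encode_surj s : exists x, encode x = s.
Proof.
have phi1 : phi 1%g = 1%g.
  by apply: (@mulgI _ (phi 1%g)); rewrite -gmulfM !mulg1.
have iter1 n : iter n phi 1%g = 1%g by elim: n => //= n ->.
pose A l := [set x | code l x = set_val (set_val s l)].
have [|||x xA] := @compact_nested_meet X A X_compact.
- move=> l x clx; have [y [yA yx]] := clx _ (code_locally_constant l x).
  by rewrite /A /= -yA; exact/esym/yx.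
- move=> l; have [k _ kE] := set_valP (set_val s l).
  by have [x xE] := code_surj l k; exists x; rewrite /A /= xE.
- move=> l x xA; have [g [e1 e2]] := set_valP s l.
  (* [g] belongs to its own coset at level [l.+1], hence to the code of [x] at
     level [l.+1], and so to its code at level [l]. *)
  rewrite /A /= [RHS]e2; apply: codeE; apply: code_nested.
  rewrite [code _ _]xA [X in X g]e1; exists 1%g; last by rewrite mulg1.
  by exists 1%g => //; exact: iter1.
exists x; apply: val_inj; apply: functional_extensionality_dep => l.
by apply: val_inj; exact: xA.
Qed.

(** The inverse is continuous because the coordinate of index [l] alone already
determines the point up to an error that tends to 0 as [l] grows. *)
Lemma encode_homeomorphism : homeomorphism encode.
Proof.
split; first exact: encode_continuous.
have [decode decodeK] := choice encode_surj.
have codeK s l : code l (decode s) = set_val (set_val s l).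
  by rewrite -encode_code decodeK.
have encode_inj : injective encode.
  move=> x y xy; apply/eqP; rewrite -[_ == _]negbK -mdist_gt0.
  apply/negP => /code_small[l small].
  by have := small x y; rewrite -!encode_code xy => /(_ erefl); rewrite ltxx.
exists decode; split=> // [s A /nbhs_ballP[eps /= eps0 ballA]|x]; last first.
  exact: encode_inj.
have [l small] := code_small eps0.
have : nbhs s [set t : renorm_limit phi | set_val t l = set_val s l].
  have cont : {for s, continuous
      ((@proj _ (fun l => discrete_topology (left_cosets (iter_image phi l))) l)
       \o (set_val : renorm_limit phi -> coset_sequences phi))}.
    apply: continuous_comp; first exact: initial_continuous.
    exact: proj_continuous.
  exact: cont _ (discrete_set1 (set_val s l :
    discrete_topology (left_cosets (iter_image phi l)))).
apply: filterS => t /= ts; apply: ballA; rewrite ballEmdist /=.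
by apply: small; rewrite !codeK ts.
Qed.

Lemma encode_equivariant g x :
  encode (Phi g x) = renorm_limit_action phi g (encode x).
Proof.
apply: val_inj; apply: functional_extensionality_dep => l.
by apply: val_inj; exact: code_translate.
Qed.

End renormalization.

End domains.

Theorem theorem1p6 (R : realType) (X : metricType R) (G : groupType)
    (Phi : G -> X -> X) :
  cantor_action Phi ->
  equicontinuous_action Phi ->
  renormalizable_action Phi ->
  (quasi_analytic Phi \/ wild_action Phi) /\
  (quasi_analytic Phi ->
     renormalizable_group G /\
     exists2 phi : {multiplicative G -> G}, is_renormalization phi &
       topologically_conjugate Phi (renorm_limit_action phi)).
Proof.
move=> cantorPhi equiPhi renPhi.
have [L cL] := renormalizable_action_contraction cantorPhi renPhi.
split.
  have [stable|wild] := pselect (stable_action Phi); last by right.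
  by left; exact: stable_quasi_analytic cantorPhi cL stable.
move=> qaPhi.
have [phi phiE] := exists_intertwiner cantorPhi cL qaPhi.
have phi_ren := intertwiner_renormalization cantorPhi cL qaPhi phiE.
split; first by exists phi.
exists phi => //; exists (encode cantorPhi cL qaPhi phiE).
  exact: encode_homeomorphism.
exact: encode_equivariant.
Qed.
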